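(* Let $(\mathsf X_n,\mathrm d_n)_{n\in\mathbb N}$ be finite metric spaces with $|\mathsf X_n|=n$, all $(C,\delta)$-finite-Ahlfors regular for fixed constants $0<C<\infty$, $1\le\delta\le\infty$. Assume there is a constant $K$ independent of $n$ such that for each $n$: (1) $\mathsf X_n$ is $K$-coarsely isometric to a subset of a Euclidean space of dimension $\nu$ independent of $n$; and (2) for any two points $i,j\in\mathsf X_n$ and any $a\in[0,1]$ there is an interpolant $g\in\mathsf X_n$ with $|\mathrm d_n(i,g)-a\,\mathrm d_n(i,j)|\le K$ and $|\mathrm d_n(g,j)-(1-a)\,\mathrm d_n(i,j)|\le K$. Fix an integer $k\ge2$ and let $\mathcal C_n$ be a partition of $\mathsf X_n$ returned by the $k$-medoids algorithm applied to $(\mathsf X_n,\mathrm d_n)$. Then the sequence $(\mathcal C_n)_{n\in\mathbb N}$ satisfies: (i) $\liminf_{n\to\infty}\min_{\mathsf C\in\mathcal C_n}|\mathsf C|/\max_{\mathsf D\in\mathcal C_n}|\mathsf D|>0$; and (ii) there is a sequence $\bar r_n\nearrow\infty$ with $\lim_{n\to\infty}\max_{\mathsf C\in\mathcal C_n}|\{i\in\mathsf C:\mathrm d_n(i,\mathsf X_n\setminus\mathsf C)\le\bar r_n\}|/\min_{\mathsf D\in\mathcal C_n}|\mathsf D|=0$.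
   Context: A finite metric space $(\mathsf X,\mathrm d)$ is $(C,\delta)$-finite-Ahlfors regular if for every $i\in\mathsf X$ and $r>0$, $\min(|\mathsf X|,C^{-1}r^\delta)\le|\mathsf B_{\mathsf X,r}(i)|\le\max(Cr^\delta,1)$, with $\mathsf B_{\mathsf X,r}(i)$ the ball of radius $r$ about $i$. A map $f:(\mathsf Y,\mathrm d_{\mathsf Y})\to(\mathsf Z,\mathrm d_{\mathsf Z})$ is a $K$-coarse isometry if $\mathrm d_{\mathsf Z}(f(i),f(j))-K\le\mathrm d_{\mathsf Y}(i,j)\le\mathrm d_{\mathsf Z}(f(i),f(j))+K$ for all $i,j$. The $k$-medoids algorithm on a finite metric space $(\mathsf X,\mathrm d)$: for medoids $i_1,\dots,i_k\in\mathsf X$, each point is assigned to a cluster of a nearest medoid; the total cost is $\sum_{g}\sum_{j\in\mathsf C_g}\mathrm d(i_g,j)^2$. Initialize medoids arbitrarily; while the total cost decreases, for each $g\le k$ and each non-medoid $j$, compute the cost with medoid set $\{i_1,\dots,i_{g-1},j,i_{g+1},\dots,i_k\}$ and update to the new medoids if the total cost decreases. The output is the resulting partition into $k$ clusters. *)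

(* Defs.v *)
From HB Require Import structures.
From mathcomp Require Import all_boot all_order all_algebra.
From mathcomp Require Import all_classical all_reals all_analysis.
From Stdlib Require Import Relations.Relation_Operators.
Set Implicit Arguments. Unset Strict Implicit. Unset Printing Implicit Defensive.
Import Order.TTheory GRing.Theory Num.Theory.
Local Open Scope ring_scope.

Section Defs.
Context {R : realType}.

Definition is_metric (n : nat) (d : 'I_n -> 'I_n -> R) : Prop :=
  [/\ forall i j, 0 <= d i j,
      forall i j, d i j = 0 <-> i = j,
      forall i j, d i j = d j i &
      forall i j l, d i l <= d i j + d j l].

Definition ball_set (n : nat) (d : 'I_n -> 'I_n -> R) (r : R) (i : 'I_n)
  : {set 'I_n} := [set j | d i j <= r].

(* r ^ delta for r > 0 and delta in [1, +oo]; for delta = +oo we use the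
   limiting convention r^oo = 0 (r<1), 1 (r=1), +oo (r>1). *)
Definition epow (r : R) (delta : \bar R) : \bar R :=
  match delta with
  | EFin x => (r `^ x)%:E
  | +oo%E => if r < 1 then 0%E else if r == 1 then 1%E else +oo%E
  | -oo%E => 0%E
  end.

Definition finite_ahlfors (n : nat) (d : 'I_n -> 'I_n -> R) (C : R)
    (delta : \bar R) : Prop :=
  forall (i : 'I_n) (r : R), 0 < r ->
    (Order.min (n%:R)%:E ((C^-1)%:E * epow r delta)
       <= (#|ball_set d r i|%:R)%:E)%E /\
    ((#|ball_set d r i|%:R)%:E
       <= Order.max ((C%:E) * epow r delta) 1%E)%E.

Definition eucl_dist (nu : nat) (x y : 'rV[R]_nu) : R :=
  Num.sqrt (\sum_(l < nu) (x ord0 l - y ord0 l) ^+ 2).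

Definition coarse_isometry (n nu : nat) (d : 'I_n -> 'I_n -> R) (K : R)
    (f : 'I_n -> 'rV[R]_nu) : Prop :=
  forall i j, eucl_dist (f i) (f j) - K <= d i j /\
              d i j <= eucl_dist (f i) (f j) + K.

Definition nearest_assign (n k : nat) (d : 'I_n -> 'I_n -> R)
    (m : {ffun 'I_k -> 'I_n}) (a : 'I_n -> 'I_k) : Prop :=
  forall j g, d (m (a j)) j <= d (m g) j.

Definition kcost (n k : nat) (d : 'I_n -> 'I_n -> R)
    (m : {ffun 'I_k -> 'I_n}) (a : 'I_n -> 'I_k) : R :=
  \sum_(g < k) \sum_(j < n | a j == g) d (m g) j ^+ 2.

Definition swap_of (n k : nat) (m m' : {ffun 'I_k -> 'I_n}) : Prop :=
  exists (g : 'I_k) (j : 'I_n),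
    (forall h, m h != j) /\ m' = [ffun h => if h == g then j else m h].

Definition cost_decreases (n k : nat) (d : 'I_n -> 'I_n -> R)
    (m m' : {ffun 'I_k -> 'I_n}) : Prop :=
  exists a a', [/\ nearest_assign d m a, nearest_assign d m' a' &
                   kcost d m' a' < kcost d m a].

Definition kmedoids_step (n k : nat) (d : 'I_n -> 'I_n -> R)
    (m m' : {ffun 'I_k -> 'I_n}) : Prop :=
  swap_of m m' /\ cost_decreases d m m'.

(* a : 'I_n -> 'I_k (cluster label of each point) is a partition returned by
   the k-medoids algorithm: starting from arbitrary (distinct) medoids m0,
   a finite sequence of improving swaps leads to medoids m at which no swap
   decreases the cost (so the loop stops), and a assigns every point to a
   nearest medoid of m. *)
Definition kmedoids_output (n k : nat) (d : 'I_n -> 'I_n -> R)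
    (a : 'I_n -> 'I_k) : Prop :=
  exists m0 m : {ffun 'I_k -> 'I_n},
    [/\ injective m0,
        Relation_Operators.clos_refl_trans _ (kmedoids_step d) m0 m,
        (forall m', swap_of m m' -> ~ cost_decreases d m m') &
        nearest_assign d m a].

Definition cluster (n k : nat) (a : 'I_n -> 'I_k) (g : 'I_k) : {set 'I_n} :=
  [set i | a i == g].

Definition min_cluster_size (n k : nat) (a : 'I_n -> 'I_k) : nat :=
  \big[minn/n]_(g < k) #|cluster a g|.

Definition max_cluster_size (n k : nat) (a : 'I_n -> 'I_k) : nat :=
  \max_(g < k) #|cluster a g|.

(* { i in C_g : d(i, X \ C_g) <= r }  (d(i, emptyset) = +oo) *)
Definition boundary (n k : nat) (d : 'I_n -> 'I_n -> R) (a : 'I_n -> 'I_k)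
    (r : R) (g : 'I_k) : {set 'I_n} :=
  [set i in cluster a g | [exists j, (j \notin cluster a g) && (d i j <= r)]].

Definition max_boundary_size (n k : nat) (d : 'I_n -> 'I_n -> R)
    (a : 'I_n -> 'I_k) (r : R) : nat :=
  \max_(g < k) #|boundary d a r g|.

End Defs.

(* Main.v *)
Require Import Defs.
From HB Require Import structures.
From mathcomp Require Import all_boot all_order all_algebra.
From mathcomp Require Import all_classical all_reals all_analysis.
From mathcomp Require Import ring lra.
Import Order.TTheory GRing.Theory Num.Theory.
Local Open Scope classical_set_scope.
Local Open Scope ring_scope.

(* Distances are rescaled by [n ^ (- 1 / delta)], so that diameters are bounded
   and a ball of radius [t] has about [t ^ delta * n] points (for
   [delta = +oo] Ahlfors regularity bounds [n]).

   At a local optimum the medoids stay at distance [>= c] from each other: if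
   two of them were very close, moving one to a point far from all medoids
   would decrease the cost.  Hence each cluster contains a ball of radius
   [c / 3], which gives (i).

   The boundary of a cluster lies in thin slabs
   [{i | |d(i, x) - d(i, y)| <= tau}] between two medoids [x] and [y].  In the
   Euclidean embedding, approximate geodesics are close to segments, so the
   image of the space is almost convex, and the homotheties of centre [y] and
   ratios between 1/2 and 1 map it almost into itself.  They send a thin slab to
   [M] disjoint copies of comparable size, so the slab has at most
   [O(n / M)] points, for each [M] once [n] is large. *)

(** * Euclidean geometry: Cauchy-Schwarz, points on segments, the bisector function *)

Section Euclidean.
Context {R : realType} {nu : nat}.
Implicit Types (u v p q x y : 'rV[R]_nu) (s : R).

Let dot u v : R := \sum_(l < nu) u ord0 l * v ord0 l.

Let dot_ge0 u : 0 <= dot u u.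
Proof. by apply: sumr_ge0 => l _; rewrite -expr2 sqr_ge0. Qed.

(** Cauchy-Schwarz: the squared norm of [dot v v *: u - dot u v *: v] is [dot v v] times the
    difference of the two sides. *)
Let sqr_dot_le u v : dot u v ^+ 2 <= dot u u * dot v v.
Proof.
have [v0|vN0] := eqVneq (dot v v) 0.
  have vz l : v ord0 l = 0.
    have /(_ l isT)/eqP := psumr_eq0P (fun l _ => sqr_ge0 (v ord0 l)) v0.
    by rewrite sqrf_eq0 => /eqP.
  by rewrite v0 mulr0 /dot big1 ?expr0n // => l _; rewrite vz mulr0.
have v_gt0 : 0 < dot v v by rewrite lt_def vN0 dot_ge0.
have : 0 <= dot (dot v v *: u - dot u v *: v) (dot v v *: u - dot u v *: v).
  exact: dot_ge0.
have -> a b : dot (a *: u - b *: v) (a *: u - b *: v) =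
    a ^+ 2 * dot u u - 2 * a * b * dot u v + b ^+ 2 * dot v v.
  rewrite /dot !mulr_sumr -sumrB -big_split; apply: eq_bigr => l _ /=.
  by rewrite !mxE; ring.
rewrite (_ : _ + _ = dot v v * (dot u u * dot v v - dot u v ^+ 2)).
  by rewrite pmulr_rge0 // subr_ge0.
by ring.
Qed.

Let eucl_distE x y : eucl_dist x y = Num.sqrt (dot (x - y) (x - y)).
Proof. by congr Num.sqrt; apply: eq_bigr => l _; rewrite !mxE expr2. Qed.

Let sqr_eucl_dist x y : eucl_dist x y ^+ 2 = dot (x - y) (x - y).
Proof. by rewrite eucl_distE sqr_sqrtr. Qed.

Let dot_le u v : `|dot u v| <= Num.sqrt (dot u u) * Num.sqrt (dot v v).
Proof. by rewrite -sqrtrM // -sqrtr_sqr ler_sqrt // mulr_ge0. Qed.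

Lemma eucl_dist_ge0 x y : 0 <= eucl_dist x y.
Proof. exact: sqrtr_ge0. Qed.

Lemma eucl_dist_refl x : eucl_dist x x = 0.
Proof. by rewrite /eucl_dist big1 ?sqrtr0 // => l _; rewrite subrr expr0n. Qed.

Lemma eucl_distC x y : eucl_dist x y = eucl_dist y x.
Proof. by congr Num.sqrt; apply: eq_bigr => l _; rewrite -sqrrN opprB. Qed.

Lemma eucl_dist_triangle x y z :
  eucl_dist x z <= eucl_dist x y + eucl_dist y z.
Proof.
rewrite -(ler_pXn2r (n := 2)) ?nnegrE ?addr_ge0 ?eucl_dist_ge0 //.
have -> : eucl_dist x z ^+ 2 = eucl_dist x y ^+ 2 + 2 * dot (x - y) (y - z)
                               + eucl_dist y z ^+ 2.
  rewrite !sqr_eucl_dist /dot mulr_sumr -!big_split; apply: eq_bigr => l _ /=.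
  by rewrite !mxE; ring.
have := le_trans (ler_norm _) (dot_le (x - y) (y - z)).
rewrite -!eucl_distE; nra.
Qed.

Lemma eucl_dist_homothety s p p' q : 0 <= s ->
  eucl_dist (s *: p + q) (s *: p' + q) = s * eucl_dist p p'.
Proof.
move=> s0; rewrite -[in RHS](ger0_norm s0) -sqrtr_sqr -sqrtrM ?sqr_ge0 //.
congr Num.sqrt; rewrite mulr_sumr; apply: eq_bigr => l _.
by rewrite !mxE; ring.
Qed.

Lemma stewart s g p q :
  eucl_dist g ((1 - s) *: p + s *: q) ^+ 2 =
  (1 - s) * eucl_dist g p ^+ 2 + s * eucl_dist g q ^+ 2
  - s * (1 - s) * eucl_dist p q ^+ 2.
Proof.
rewrite !sqr_eucl_dist /dot !mulr_sumr -big_split -sumrB.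
by apply: eq_bigr => l _ /=; rewrite !mxE; ring.
Qed.

(* Its zero set is the bisector of [x] and [y]. *)
Definition power_difference x y z : R :=
  eucl_dist z x ^+ 2 - eucl_dist z y ^+ 2.

(** The quadratic terms of [stewart] cancel, so [power_difference] is affine along segments. A
    contraction towards [y] thus shifts its zero level by [s * eucl_dist x y ^+ 2]. *)
Lemma power_difference_convex s p x y :
  power_difference x y ((1 - s) *: p + s *: y) =
  (1 - s) * power_difference x y p + s * eucl_dist x y ^+ 2.
Proof.
rewrite /power_difference !(eucl_distC (_ + _)) !stewart eucl_dist_refl.
rewrite (eucl_distC x p) (eucl_distC y p); ring.
Qed.

(** [power_difference x y] is affine with gradient [2 * (y - x)], so Cauchy-Schwarz applies. *)
Lemma power_difference_lipschitz p p' x y :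
  `|power_difference x y p - power_difference x y p'|
    <= 2 * eucl_dist p p' * eucl_dist x y.
Proof.
have -> : power_difference x y p - power_difference x y p' =
          2 * dot (p - p') (y - x).
  rewrite /power_difference !sqr_eucl_dist /dot mulr_sumr -!sumrB.
  by apply: eq_bigr => l _; rewrite !mxE; ring.
rewrite normrM ger0_norm // -mulrA ler_pM2l //.
by rewrite (eucl_distC x) !eucl_distE dot_le.
Qed.

(** In [stewart] the main terms cancel, leaving at most [12 * s * (1 - s) * K * l + 9 * K ^+ 2],
    where [l] is the distance of [p] and [q]. The error [E] is thus of order the square root of
    [K * A]. *)
Lemma approximate_interpolant K A E s g p q :
  0 <= s <= 1 -> 0 <= K -> 0 <= E -> 3 * K * A + 9 * K ^+ 2 <= E ^+ 2 ->
  eucl_dist p q <= A ->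
  eucl_dist g p <= s * eucl_dist p q + 3 * K ->
  eucl_dist g q <= (1 - s) * eucl_dist p q + 3 * K ->
  eucl_dist g ((1 - s) *: p + s *: q) <= E.
Proof.
move=> s01 K0 E0 hE lA gp gq.
rewrite -(ler_pXn2r (n := 2)) ?nnegrE ?eucl_dist_ge0 // stewart.
apply: le_trans hE.
have l0 := eucl_dist_ge0 p q; set l := eucl_dist p q in lA gp gq l0 *.
have /andP[s0 s1'] := s01.
have s1 : 0 <= 1 - s by lra.
have K3 : 0 <= 3 * K by rewrite mulr_ge0.
have gp2 : eucl_dist g p ^+ 2 <= (s * l + 3 * K) ^+ 2.
  by rewrite ler_pXn2r // nnegrE ?eucl_dist_ge0 // addr_ge0 // mulr_ge0.
have gq2 : eucl_dist g q ^+ 2 <= ((1 - s) * l + 3 * K) ^+ 2.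
  by rewrite ler_pXn2r // nnegrE ?eucl_dist_ge0 // addr_ge0 // mulr_ge0.
have := ler_wpM2l s1 gp2; have := ler_wpM2l s0 gq2.
have KlA : K * l <= K * A by exact: ler_wpM2l.
have Kl : 0 <= K * l by exact: mulr_ge0.
(* This encodes [s * (1 - s) <= 1 / 4]. *)
have : 0 <= K * l * (1 - 2 * s) ^+ 2 by rewrite mulr_ge0 ?sqr_ge0.
nra.
Qed.

End Euclidean.

(** * Union bound, local optima of the cost and separation of the medoids *)

Lemma leq_card_covering (I T : finType) (S : {set T}) (F : I -> {set T}) :
  (forall x, x \in S -> exists i, x \in F i) -> (#|S| <= \sum_i #|F i|)%N.
Proof.
move=> cover; rewrite -sum1_card big_mkcond.
under [leqRHS]eq_bigr do rewrite -sum1_card big_mkcond.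
rewrite exchange_big; apply: leq_sum => x _; case: ifP => // /cover[i xi].
by rewrite (bigD1 i) //= xi.
Qed.

Section LocalOptimum.
Context {R : realType} {n k : nat}.
Implicit Types (d : 'I_n -> 'I_n -> R) (m : {ffun 'I_k -> 'I_n}).
Implicit Types (a : 'I_n -> 'I_k).

Definition local_optimum d m : Prop :=
  forall m', swap_of m m' -> ~ cost_decreases d m m'.

Lemma kcostE d m a : kcost d m a = \sum_z d (m (a z)) z ^+ 2.
Proof.
rewrite [RHS](partition_big a xpredT) //=.
by apply: eq_bigr => g _; apply: eq_bigr => z /eqP ->.
Qed.

Lemma nearest_assign_exists d m (g : 'I_k) : exists a, nearest_assign d m a.
Proof.
exists (fun z => [arg min_(l < g) d (m l) z]%O) => z l.
by case: arg_minP => // i _; apply.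
Qed.

(** A nearest assignment costs no more than any other, so local optimality can be tested against an
    arbitrary assignment [b] after the swap. *)
Lemma local_optimum_le d m (g : 'I_k) j a (b : 'I_n -> 'I_k) :
  is_metric d -> local_optimum d m -> (forall l, m l != j) ->
  nearest_assign d m a ->
  \sum_z d (m (a z)) z ^+ 2 <=
  \sum_z d (if b z == g then j else m (b z)) z ^+ 2.
Proof.
move=> [d_ge0 _ _ _] opt mj ma.
set m' : {ffun 'I_k -> 'I_n} := [ffun h => if h == g then j else m h].
have [a' ma'] := nearest_assign_exists d m' g.
have [le_mm'|lt_mm'] := leP (kcost d m a) (kcost d m' a'); last first.
  by exfalso; apply: (opt m'); [exists g, j | exists a, a'].
rewrite !kcostE in le_mm'; apply: le_trans le_mm' _.
apply: ler_sum => z _; have := ma' z (b z).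
by rewrite [m' (b z)]ffunE => ?; rewrite ler_pXn2r ?nnegrE.
Qed.

(* If [m g] and [m h] were close, then swapping [m g] for the far point [j]
   would send the cluster of [g] to [m h] at a small cost, and the ball around
   [j] would gain [rho ^+ 2 / 2] per point. *)
Lemma medoids_separated d m (A rho : R) (g h : 'I_k) j :
  is_metric d -> (forall x y, d x y <= A) -> local_optimum d m ->
  g != h -> 0 < rho -> (forall l, rho < d (m l) j) ->
  #|ball_set d (rho / 4) j|%:R * (rho ^+ 2 / 2) <=
  n%:R * (3 * A * d (m g) (m h)).
Proof.
move=> md dA opt gh rho0 far; have [d_ge0 d_eq0 dC dT] := md.
have mj l : m l != j.
  apply/eqP => mlj; have := far l; rewrite mlj (iffRL (d_eq0 j j) erefl).
  by rewrite ltNge ltW.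
have [a ma] := nearest_assign_exists d m g.
pose b z := if d j z <= rho / 4 then g else if a z == g then h else a z.
have := local_optimum_le d m g j a b md opt mj ma.
have pt z : d (if b z == g then j else m (b z)) z ^+ 2 <=
    d (m (a z)) z ^+ 2 + 3 * A * d (m g) (m h)
    - (z \in ball_set d (rho / 4) j)%:R * (rho ^+ 2 / 2).
  have A0 : 0 <= A := le_trans (d_ge0 z z) (dA z z).
  have e0 := d_ge0 (m g) (m h); have eA := dA (m g) (m h).
  have Ae0 : 0 <= A * d (m g) (m h) by exact: mulr_ge0.
  (* Near [j] the distance drops from at least [3 * rho / 4] to at most [rho / 4], a gain of
     [rho ^+ 2 / 2] in squares. A point moved from [g] to [h] loses at most
     [e ^+ 2 + 2 * A * e <= 3 * A * e], with [e = d (m g) (m h)]. *)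
  rewrite inE /b; have [jz|_] := boolP (d j z <= _).
    rewrite eqxx mul1r; have := far (a z); have := dT (m (a z)) z j.
    rewrite (dC z j); have := d_ge0 j z; nra.
  rewrite mul0r subr0; have [az|/negPf azg] := eqVneq (a z) g.
    rewrite eq_sym (negPf gh) az; have := dT (m h) (m g) z.
    rewrite (dC (m h) (m g)) => hz.
    have : d (m h) z ^+ 2 <= (d (m g) (m h) + d (m g) z) ^+ 2.
      by rewrite ler_pXn2r ?nnegrE ?addr_ge0.
    have := ler_wpM2r e0 eA; have := ler_wpM2r e0 (dA (m g) z); lra.
  by rewrite azg lerDl -mulrA mulr_ge0.
move=> /le_trans/(_ (ler_sum _ (fun z _ => pt z))).
rewrite sumrB big_split /= -addrA lerDl subr_ge0 -mulr_suml.
rewrite sumr_const card_ord => le_sum; rewrite [leRHS]mulr_natl.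
apply: (le_trans _ le_sum).
by rewrite -natr_sum -big_mkcond sum1_card.
Qed.

(** Otherwise the [k] balls of radius [rho] around the medoids would cover the space. *)
Lemma far_from_medoids d m (rho b : R) :
  is_metric d -> (forall i, #|ball_set d rho i|%:R <= b) ->
  k%:R * b < n%:R -> exists j, forall l, rho < d (m l) j.
Proof.
move=> [_ _ dC _] ball_le; apply: contraPP => /forallNP near; apply/negP.
rewrite -leNgt; have : (n <= \sum_(l < k) #|ball_set d rho (m l)|)%N.
  rewrite -{1}(card_ord n) -cardsT; apply: leq_card_covering => j _.
  have /existsNP[l /negP] := near j; rewrite -leNgt => lj.
  by exists l; rewrite inE.
rewrite -(ler_nat R) natr_sum => /le_trans; apply.
apply: le_trans (ler_sum _ (fun l _ => ball_le (m l))) _.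
by rewrite sumr_const card_ord mulr_natl.
Qed.

End LocalOptimum.

(* In [slab_card], [w] bounds the distance of two points of the copies of
   parameters [s'] and [s], on which the [power_difference] takes the values
   [(1 - s) * hp + s * L ^+ 2] and [(1 - s') * hq + s' * L ^+ 2]. *)
Lemma separated_levels {R : realFieldType} (L c H w s s' hp hq M : R) :
  0 < L -> 0 < M -> c + H / L < L / (4 * M) -> `|hp| <= H -> `|hq| <= H ->
  0 <= s' -> s <= 1 -> 1 / (2 * M) <= s - s' ->
  `|(1 - s) * hp + s * L ^+ 2 - ((1 - s') * hq + s' * L ^+ 2)| <= 2 * w * L ->
  c < w.
Proof.
move=> L0 M0 cHL; rewrite !ler_norml => /andP[hp1 hp2] /andP[_ hq2] s'0 s1 ss'.
move=> /andP[_ lip]; rewrite ltNge; apply/negP => wc.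
have LE : c * L * 2 + H * 2 < (s - s') * L ^+ 2.
  apply: (@lt_le_trans _ _ (1 / (2 * M) * L ^+ 2)); last first.
    by rewrite ler_pM2r ?exprn_gt0.
  have -> : c * L * 2 + H * 2 = (c + H / L) * (L * 2) by field; lra.
  have -> : 1 / (2 * M) * L ^+ 2 = L / (4 * M) * (L * 2) by field; lra.
  by rewrite ltr_pM2r ?mulr_gt0.
have wL : w * L <= c * L by rewrite ler_pM2r.
have H0 : 0 <= H by lra.
have M20 : 0 < 1 / (2 * M) by rewrite divr_gt0 ?mulr_gt0.
have : (1 - s) * - H <= (1 - s) * hp by apply: ler_wpM2l => //; lra.
have : (1 - s') * hq <= (1 - s') * H by apply: ler_wpM2l => //; lra.
have : 0 <= s * H by rewrite mulr_ge0 //; lra.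
have : 0 <= s' * H by rewrite mulr_ge0.
lra.
Qed.

(** * Counting the points of a slab between two points *)

Section Slab.
Context {R : realType} {n nu : nat}.
Variables (d : 'I_n -> 'I_n -> R) (f : 'I_n -> 'rV[R]_nu) (K A E : R).
Hypothesis md : is_metric d.
Hypothesis dA : forall i j, d i j <= A.
Hypothesis iso : coarse_isometry d K f.
Hypothesis interpolation : forall i j (a : R), 0 <= a <= 1 ->
  exists g, `|d i g - a * d i j| <= K /\ `|d g j - (1 - a) * d i j| <= K.
Hypothesis E_ge0 : 0 <= E.
Hypothesis le_E : 3 * K * (A + K) + 9 * K ^+ 2 <= E ^+ 2.

Lemma coarse_constant_ge0 (i : 'I_n) : 0 <= K.
Proof.
have [+ _] := iso i i; rewrite eucl_dist_refl.
by have [_ /(_ i i)[_ ->] // _ _] := md; rewrite sub0r oppr_le0.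
Qed.

(** Interpolation costs [K], and so does each passage between [d] and the Euclidean distance: this
    is the [3 * K] of [approximate_interpolant]. *)
Lemma approximate_convexity i y (s : R) : 0 <= s <= 1 ->
  exists g, eucl_dist (f g) ((1 - s) *: f i + s *: f y) <= E.
Proof.
move=> s01; have [g [ig gy]] := interpolation i y s s01; exists g.
have K0 := coarse_constant_ge0 i; have /andP[s0 s1] := s01.
move: ig gy; rewrite !ler_norml => /andP[_ ig] /andP[_ gy].
have [i1 i2] := iso i y; have [g1 _] := iso i g; have [y1 _] := iso g y.
apply: (approximate_interpolant K (A + K)) => //.
- have := dA i y; lra.
- rewrite eucl_distC.
  have : s * d i y <= s * (eucl_dist (f i) (f y) + K) by exact: ler_wpM2l.
  have : s * K <= 1 * K by exact: ler_wpM2r.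
  by rewrite mulrDr; lra.
- have s1' : 0 <= 1 - s by lra.
  have := ler_wpM2l s1' i2.
  have : (1 - s) * K <= 1 * K by apply: ler_wpM2r; lra.
  by rewrite mulrDr; lra.
Qed.

(** Factor the difference of squares: one factor is at most [tau + 2 * K], the other at most
    [2 * (A + K)]. *)
Lemma power_difference_slab tau x y i : `|d i x - d i y| <= tau ->
  `|power_difference (f x) (f y) (f i)| <= 2 * (tau + 2 * K) * (A + K).
Proof.
move=> xy; have K0 := coarse_constant_ge0 i.
rewrite /power_difference subr_sqr normrM.
have [x1 x2] := iso i x; have [y1 y2] := iso i y.
have := dA i x; have := dA i y => yA xA.
rewrite [2 * _]mulrC -mulrA; apply: ler_pM => //.
  by move: xy; rewrite !ler_norml; lra.
by rewrite ger0_norm ?addr_ge0 ?eucl_dist_ge0 //; lra.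
Qed.

(* The contractions [p |-> (1 - s) p + s y], for [s = l / (2 M)] and [l < M],
   move the slab between [x] and [y] to [M] far apart slabs without collapsing
   it, and almost preserve [f @: setT].  Counting the points near these [M]
   copies bounds the size of the slab. *)
Lemma slab_card (M : nat) (tau sigma rho lo up : R) x y :
  let L := eucl_dist (f x) (f y) in
  (0 < M)%N -> 0 < L ->
  4 * sigma + 3 * K + 4 * E <= rho ->
  2 * sigma + K + 2 * E + 2 * (tau + 2 * K) * (A + K) / L < L / (4 * M%:R) ->
  (forall i, lo <= #|ball_set d sigma i|%:R) ->
  (forall i, #|ball_set d rho i|%:R <= up) ->
  M%:R * #|[set i | `|d i x - d i y| <= tau]%SET|%:R * lo <= n%:R * up.
Proof.
move=> L M0 L0 rhoE LE loP upP; have [d_ge0 d_eq0 dC dT] := md.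
have K0 := coarse_constant_ge0 x.
set T := [set i | _]%SET.
have TP i : i \in T -> `|d i x - d i y| <= tau by rewrite inE.
pose s (l : 'I_M) : R := l%:R / (2 * M%:R).
have M0' : 0 < M%:R :> R by rewrite ltr0n.
have s01 l : 0 <= s l <= 1 / 2.
  rewrite divr_ge0 ?mulr_ge0 //= ler_pdivrMr ?mulr_gt0 //.
  have : l%:R <= M%:R :> R by rewrite ler_nat ltnW.
  lra.
have s_gap (l l' : 'I_M) : (l' < l)%N -> 1 / (2 * M%:R) <= s l - s l'.
  move=> l'l; rewrite /s -mulrBl ler_pM2r ?invr_gt0 ?mulr_gt0 //.
  rewrite lerBrDr nat1r ler_nat; exact: l'l.
have ex_phi (p : 'I_M * 'I_n) : exists g,
    eucl_dist (f g) ((1 - s p.1) *: f p.2 + s p.1 *: f y) <= E.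
  by apply: approximate_convexity; have := s01 p.1; lra.
have [phi phiP] := choice ex_phi.
(* The proof counts the pairs [(p, z)] with [p \in P z] in two ways: each [p] over the slab has at
   least [lo] such [z], each [z] at most [up] such [p]. *)
pose P z := [set p : 'I_M * 'I_n | (p.2 \in T) && (d (phi p) z <= sigma)]%SET.
have close p q z : p \in P z -> q \in P z ->
    eucl_dist ((1 - s p.1) *: f p.2 + s p.1 *: f y)
              ((1 - s q.1) *: f q.2 + s q.1 *: f y) <= 2 * sigma + K + 2 * E.
  rewrite !inE => /andP[_ pz] /andP[_ qz].
  have := eucl_dist_triangle ((1 - s p.1) *: f p.2 + s p.1 *: f y) (f (phi p))
            ((1 - s q.1) *: f q.2 + s q.1 *: f y).
  have := eucl_dist_triangle (f (phi p)) (f (phi q))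
            ((1 - s q.1) *: f q.2 + s q.1 *: f y).
  have := phiP p; rewrite eucl_distC; have := phiP q.
  have [+ _] := iso (phi p) (phi q).
  have := dT (phi p) z (phi q); rewrite (dC z); lra.
(* For distinct parameters the levels of [power_difference] differ by more than its Lipschitz bound
   allows for two points near the same [z]. *)
have same_s p q z : p \in P z -> q \in P z -> p.1 = q.1.
  have lt_absurd p' q' : p' \in P z -> q' \in P z -> (q'.1 < p'.1)%N -> False.
    move=> pz qz qp; have := close p' q' z pz qz.
    have [pT qT] : p'.2 \in T /\ q'.2 \in T.
      by move: pz qz; rewrite ![_ \in P z]inE => /andP[-> _] /andP[-> _].
    set wp := _ + s p'.1 *: _; set wq := _ + s q'.1 *: _.
    have := power_difference_lipschitz wp wq (f x) (f y).
    have := power_difference_slab tau x y p'.2 (TP _ pT).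
    have := power_difference_slab tau x y q'.2 (TP _ qT).
    rewrite !power_difference_convex -/L => hq hp lip wc.
    suff : 2 * sigma + K + 2 * E < eucl_dist wp wq by rewrite ltNge wc.
    apply: (separated_levels L _ _ _ (s p'.1) (s q'.1) _ _
              M%:R _ _ LE hp hq) => //.
    - by have /andP[] := s01 q'.1.
    - by have /andP[_] := s01 p'.1; lra.
    - exact: s_gap qp.
  move=> pz qz; have [pq|qp|/val_inj //] := ltngtP (val p.1) (val q.1).
  - by case: (lt_absurd _ _ qz pz pq).
  - by case: (lt_absurd _ _ pz qz qp).
(* The homothety ratio [1 - s p.1] is at least 1/2, so undoing it at most doubles
   [2 * sigma + K + 2 * E]; a last [K] returns to [d]. *)
have near_i p q z : p \in P z -> q \in P z -> d p.2 q.2 <= rho.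
  move=> pz qz; have pq := same_s p q z pz qz; have := close p q z pz qz.
  have := s01 p.1; rewrite -pq => s01p; rewrite eucl_dist_homothety; last lra.
  have [_] := iso p.2 q.2; have := eucl_dist_ge0 (f p.2) (f q.2); nra.
have cardP z : #|P z|%:R <= up.
  have [->|[p pz]] := set_0Vmem (P z).
    by rewrite cards0; exact: le_trans (upP x).
  apply: le_trans (upP p.2); rewrite ler_nat.
  have injP : {in P z &, injective (@snd 'I_M 'I_n)}.
    move=> [l i] [l' i'] /= pz1 pz2 ii'.
    by have /= -> := same_s _ _ _ pz1 pz2; rewrite ii'.
  rewrite -(card_in_imset injP); apply: subset_leq_card.
  apply/fintype.subsetP => i /imsetP[q qz ->]; rewrite inE.
  exact: near_i pz qz.
have -> : n%:R * up = \sum_(z < n) up by rewrite sumr_const card_ord mulr_natl.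
apply: le_trans (ler_sum _ (fun z _ => cardP z)).
have -> : \sum_z #|P z|%:R =
          \sum_(p in finset.setX [set: 'I_M]%SET T)
            #|ball_set d sigma (phi p)|%:R :> R.
  rewrite -!natr_sum; congr (_%:R).
  under eq_bigr do rewrite -sum1_card big_mkcond.
  rewrite exchange_big [RHS]big_mkcond; apply: eq_bigr => p _ /=.
  rewrite !inE /=; case: ifP => pT.
    rewrite -sum1_card [RHS]big_mkcond; apply: eq_bigr => z _.
    by rewrite !inE pT.
  by rewrite big1 // => z _; rewrite !inE pT.
apply: le_trans (ler_sum _ (fun p _ => loP (phi p))).
by rewrite sumr_const cardsX cardsT card_ord -natrM mulr_natl.
Qed.

End Slab.

(** * Balls inside clusters, and slabs containing cluster boundaries *)

Section Clusters.
Context {R : realType} {n k : nat}.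
Variables (d : 'I_n -> 'I_n -> R) (m : {ffun 'I_k -> 'I_n}) (a : 'I_n -> 'I_k).
Hypothesis md : is_metric d.
Hypothesis ma : nearest_assign d m a.

Lemma ball_sub_cluster (c : R) (g : 'I_k) :
  0 < c -> (forall h, g != h -> c <= d (m g) (m h)) ->
  ball_set d (c / 3) (m g) \subset Defs.cluster a g.
Proof.
move=> c0 sep; have [d_ge0 _ dC dT] := md.
apply/fintype.subsetP => z; rewrite !inE => gz.
apply/negPn/negP; rewrite eq_sym => /sep; have := ma z g.
by have := dT (m g) z (m (a z)); rewrite (dC z); lra.
Qed.

(** If [i] in cluster [g] is within [r] of [j] in cluster [h], then [d i (m g) <= d i (m h) <= d j
    (m h) + r <= d j (m g) + r <= d i (m g) + 2 * r], so [i] lies in the slab of [g] and [h]. *)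
Lemma max_boundary_size_le (r S : R) : 0 <= S ->
  (forall g h, g != h ->
     #|[set i | `|d i (m g) - d i (m h)| <= 2 * r]%SET|%:R <= S) ->
  (max_boundary_size d a r)%:R <= k%:R * S.
Proof.
move=> S0 slab_le; have [d_ge0 _ dC dT] := md.
rewrite /max_boundary_size; elim/big_ind: _ => [|u v uS vS|g _].
- by rewrite mulr_ge0.
- by rewrite natr_max ge_max uS.
pose F h := if g == h then finset.set0
            else [set i | `|d i (m g) - d i (m h)| <= 2 * r]%SET.
have : (#|boundary d a r g| <= \sum_h #|F h|)%N.
  apply: leq_card_covering => i; rewrite !inE.
  move=> /andP[/eqP ag /existsP[j]]; rewrite inE => /andP[agj ij].
  exists (a j); rewrite /F eq_sym (negPf agj) inE ler_norml.
  have := ma i (a j); have := ma j g; rewrite ag.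
  have := dT i j (m (a j)); have := dT j i (m g); rewrite (dC j i).
  rewrite (dC _ (m g)) !(dC (m _)); have := dC (m g) i; lra.
rewrite -(ler_nat R) natr_sum => /le_trans; apply.
have -> : k%:R * S = \sum_(h < k) S by rewrite sumr_const card_ord mulr_natl.
apply: ler_sum => h _; rewrite /F; case: eqVneq => [_|/slab_le //].
by rewrite cards0.
Qed.

(** The bound [c <= n%:R] handles the default value [n] of the iterated minimum. *)
Lemma min_cluster_size_ge (c : R) : c <= n%:R ->
  (forall g, c <= #|Defs.cluster a g|%:R) -> c <= (min_cluster_size a)%:R.
Proof.
move=> cn cl; rewrite /min_cluster_size; elim/big_ind: _ => // u v cu cv.
by rewrite natr_min le_min cu.
Qed.

Lemma max_cluster_size_le : (max_cluster_size a <= n)%N.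
Proof.
by apply/bigmax_leqP => g _; apply: leq_trans (max_card _) _; rewrite card_ord.
Qed.

End Clusters.

(** * Behaviour of all notions under rescaling of the metric *)

Section Rescaling.
Context {R : realType} {n k : nat}.
Variables (d : 'I_n -> 'I_n -> R) (s : R).
Hypothesis s0 : 0 < s.

Let ds i j := s * d i j.

Lemma is_metric_scale : is_metric d -> is_metric ds.
Proof.
move=> [d_ge0 d_eq0 dC dT]; split => [i j|i j|i j|i j l].
- by rewrite mulr_ge0 // ltW.
- rewrite -d_eq0; split=> [/eqP|dij]; last by rewrite /ds dij mulr0.
  by rewrite mulf_eq0 gt_eqF //= => /eqP.
- by rewrite /ds dC.
- by rewrite /ds -mulrDr ler_pM2l.
Qed.

Lemma nearest_assign_scale (m : {ffun 'I_k -> 'I_n}) a :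
  nearest_assign ds m a <-> nearest_assign d m a.
Proof. by split=> H j g; have := H j g; rewrite /ds ler_pM2l. Qed.

Lemma local_optimum_scale (m : {ffun 'I_k -> 'I_n}) :
  local_optimum d m -> local_optimum ds m.
Proof.
move=> opt m' mm' [a [a' [/nearest_assign_scale ma /nearest_assign_scale ma']]].
move=> lt_cost; apply: (opt m' mm'); exists a, a'; split=> //.
have cs (m0 : {ffun 'I_k -> 'I_n}) a0 : kcost ds m0 a0 = s ^+ 2 * kcost d m0 a0.
  by rewrite !kcostE mulr_sumr; apply: eq_bigr => z _; rewrite exprMn.
by rewrite !cs ltr_pM2l ?exprn_gt0 in lt_cost.
Qed.

Lemma coarse_isometry_scale nu (f : 'I_n -> 'rV[R]_nu) K :
  coarse_isometry d K f -> coarse_isometry ds (s * K) (fun i => s *: f i).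
Proof.
move=> iso i j; have [ij1 ij2] := iso i j.
have := eucl_dist_homothety s (f i) (f j) 0 (ltW s0); rewrite !addr0 => ->.
by rewrite -mulrBr -mulrDr !ler_pM2l.
Qed.

Lemma interpolation_scale K :
  (forall i j (a : R), 0 <= a <= 1 -> exists g,
    `|d i g - a * d i j| <= K /\ `|d g j - (1 - a) * d i j| <= K) ->
  forall i j (a : R), 0 <= a <= 1 -> exists g,
    `|ds i g - a * ds i j| <= s * K /\ `|ds g j - (1 - a) * ds i j| <= s * K.
Proof.
move=> itp i j a a01; have [g [ig gj]] := itp i j a a01; exists g.
by rewrite /ds !(mulrCA _ s) -!mulrBr !normrM (gtr0_norm s0) !ler_pM2l.
Qed.

Lemma ball_set_scale r i : ball_set ds r i = ball_set d (r / s) i.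
Proof. by apply/setP => j; rewrite !inE ler_pdivlMr // mulrC. Qed.

End Rescaling.

Lemma cvg_natr_powR {R : realType} (p : R) : 0 < p ->
  (n%:R `^ p : R) @[n --> \oo] --> +oo.
Proof.
move=> p0; apply/cvgryPge => B.
have := nbhs_infty_ger ((Num.max B 0) `^ p^-1).
apply: filterS => n Bn; set M := Num.max B 0 in Bn.
have M0 : 0 <= M by rewrite le_max lexx orbT.
apply: (@le_trans _ _ ((M `^ p^-1) `^ p)).
  by rewrite -powRrM mulVf ?lt0r_neq0 // powRr1 // le_max lexx.
by rewrite ge0_ler_powR ?nnegrE ?powR_ge0 // ltW.
Qed.

(** * Ahlfors regularity, for infinite [delta] and after rescaling *)

Section Ahlfors.
Context {R : realType} {n : nat}.
Variables (d : 'I_n -> 'I_n -> R) (C : R).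
Hypothesis C0 : 0 < C.

Lemma ball_set_full r i : (n <= #|ball_set d r i|)%N -> forall j, d i j <= r.
Proof.
move=> nB j; suff : j \in ball_set d r i by rewrite inE.
suff -> : ball_set d r i = finset.setT by rewrite finset.in_setT.
by apply/eqP; rewrite eqEcard finset.subsetT cardsT card_ord.
Qed.

(* For [delta = +oo] every ball of radius [> 1] is the whole space, while
   balls of radius [1] are bounded. *)
Lemma finite_ahlfors_pinfty : finite_ahlfors d C +oo%E -> n%:R <= Num.max C 1.
Proof.
move=> ahl; case: n d ahl ball_set_full => [|n'] d' ahl full.
  by rewrite le_max ler01 orbT.
have le1 j : d' ord0 j <= 1.
  rewrite leNgt; apply/negP => gt1; set r := (1 + d' ord0 j) / 2.
  have r1 : 1 < r by rewrite /r; lra.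
  have [+ _] := ahl ord0 r (lt_trans ltr01 r1).
  rewrite /= (lt_gtF r1) (gt_eqF r1) gt0_muley ?lte_fin ?invr_gt0 //.
  rewrite min_l ?leey // lee_fin ler_nat => /full/(_ j); rewrite /r; lra.
have [_] := ahl ord0 1 ltr01.
rewrite /= ltxx eqxx -EFinM -EFin_max lee_fin mulr1; apply: le_trans.
rewrite ler_nat -{1}(card_ord n'.+1) -cardsT.
by apply/subset_leq_card/fintype.subsetP => j _; rewrite inE.
Qed.

Variable x : R.
Hypothesis x1 : 1 <= x.
Hypothesis n0 : (0 < n)%N.
Hypothesis ahl : finite_ahlfors d C x%:E.

Let D := (n%:R `^ x^-1 : R).
Let ds i j := D^-1 * d i j.

Let x0 : 0 < x. Proof. exact: lt_le_trans x1. Qed.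
Let xN0 : x != 0. Proof. exact: lt0r_neq0. Qed.
Let D0 : 0 < D. Proof. by rewrite powR_gt0 // ltr0n. Qed.

Let powR_scale (t : R) : 0 <= t -> (t * D) `^ x = t `^ x * n%:R.
Proof.
by move=> t0; rewrite powRM ?(ltW D0) // /D -powRrM mulVf // powRr1.
Qed.

(** At this radius the power in the lower Ahlfors bound equals [n], so every such ball is the whole
    space. *)
Lemma rescaled_diameter i j : ds i j <= C `^ x^-1.
Proof.
rewrite /ds mulrC ler_pdivrMr //; apply: ball_set_full.
have A0 : 0 < C `^ x^-1 by exact: powR_gt0.
have [+ _] := ahl i (_ * D) (mulr_gt0 A0 D0).
rewrite /= powR_scale ?(ltW A0) // -powRrM mulVf // powRr1 ?(ltW C0) //.
by rewrite -EFinM mulKf ?gt_eqF // minxx lee_fin ler_nat.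
Qed.

Lemma rescaled_ball_ge (t : R) i : 0 < t -> t <= C `^ x^-1 ->
  C^-1 * t `^ x * n%:R <= #|ball_set ds t i|%:R.
Proof.
move=> t0 tA; rewrite /ds ball_set_scale ?invr_gt0 // invrK.
have [+ _] := ahl i (t * D) (mulr_gt0 t0 D0).
rewrite /= powR_scale ?(ltW t0) // -EFinM -EFin_min lee_fin mulrA min_r //.
rewrite -[leRHS]mul1r ler_wpM2r // ler_pdivrMl // mulr1.
apply: (@le_trans _ _ ((C `^ x^-1) `^ x)).
  by rewrite ge0_ler_powR ?nnegrE ?powR_ge0 // ltW.
by rewrite -powRrM mulVf // powRr1 // ltW.
Qed.

Lemma rescaled_ball_le (t : R) i : 0 < t ->
  #|ball_set ds t i|%:R <= Num.max (C * t `^ x * n%:R) 1.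
Proof.
move=> t0; rewrite /ds ball_set_scale ?invr_gt0 // invrK.
have [_] := ahl i (t * D) (mulr_gt0 t0 D0).
by rewrite /= powR_scale ?(ltW t0) // -EFinM -EFin_max lee_fin mulrA.
Qed.

End Ahlfors.

(* The error terms of [slab_card] at scale 1: [e ^+ 2] bounds both the relative
   coarseness and the relative thickness of the slab. *)
Lemma slab_parameters {R : realFieldType} (A c M : R) :
  0 < A -> 0 < c -> 0 < M -> let rho := c / (16 * M) in
  exists2 e, 0 < e & forall K tau L, 0 <= K -> K <= e ^+ 2 -> tau <= e ^+ 2 ->
    c - K <= L -> exists E, [/\ 0 <= E, 0 < L,
      3 * K * (A + K) + 9 * K ^+ 2 <= E ^+ 2,
      4 * (rho / 5) + 3 * K + 4 * E <= rho &
      2 * (rho / 5) + K + 2 * E + 2 * (tau + 2 * K) * (A + K) / L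
        < L / (4 * M)].
Proof.
(* The witness for [E] is [e * Q]; [e * W] bounds the sum of all error terms. *)
move=> A0 c0 M0 rho; pose Q := 3 * A + 12.
pose z := (A + 1) / c; pose W := 3 + 4 * Q + 12 * z.
have rho0 : 0 < rho by rewrite divr_gt0 ?mulr_gt0.
have z0 : 0 < z by rewrite divr_gt0 // ltr_wpDr.
have W0 : 0 < W by rewrite /W /Q; lra.
(* The three bounds give [e ^+ 2 <= e], then [L >= c / 2], and errors of total at most [rho / 5]. *)
pose e := Num.min 1 (Num.min (c / 2) (rho / (5 * W))).
have e0 : 0 < e by rewrite !lt_min ltr01 !divr_gt0 ?mulr_gt0.
have e1 : e <= 1 by rewrite ge_min lexx.
have ec : e <= c / 2 by rewrite !ge_min lexx orbT.
have eW : e * W <= rho / 5.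
  have : e <= rho / (5 * W) by rewrite !ge_min lexx !orbT.
  rewrite ler_pdivlMr ?mulr_gt0 //; lra.
clearbody e; exists e => // K tau L K0 Ke te cL.
have ee : e ^+ 2 <= e by rewrite expr2 -[leRHS]mulr1 ler_pM2l.
have L2 : c / 2 <= L by lra.
have L0 : 0 < L by lra.
have ez : 0 < e * z by exact: mulr_gt0.
have eQ : 0 < e * Q by rewrite mulr_gt0 // /Q; lra.
have {}eW : 3 * e + 4 * (e * Q) + 12 * (e * z) <= rho / 5.
  have -> // : 3 * e + 4 * (e * Q) + 12 * (e * z) = e * W by rewrite /W; ring.
exists (e * Q); split=> //; first exact: ltW.
- have : 3 * K * (A + K) + 9 * K ^+ 2 <= e ^+ 2 * Q.
    have : K * K <= K * 1 by rewrite ler_wpM2l //; lra.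
    have : K * Q <= e ^+ 2 * Q by rewrite ler_pM2r // /Q; lra.
    rewrite /Q; lra.
  move=> /le_trans; apply; rewrite exprMn ler_pM2l ?exprn_gt0 //.
  by rewrite expr2 -[leLHS]mulr1 ler_pM2l /Q; lra.
- lra.
- have Lrho : 2 * rho <= L / (4 * M).
    have -> : 2 * rho = c / 2 / (4 * M) by rewrite /rho; field; lra.
    by rewrite ler_pM2r // invr_gt0 mulr_gt0.
  have : 2 * (tau + 2 * K) * (A + K) / L <= 12 * (e * z).
    rewrite ler_pdivrMr //; apply: (@le_trans _ _ (6 * e * (A + 1))).
      apply: (@le_trans _ _ (2 * (3 * e) * (A + K))).
        by rewrite ler_pM2r; lra.
      have : e * (A + K) <= e * (A + 1) by rewrite ler_pM2l //; lra.
      lra.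
    have -> : 6 * e * (A + 1) = 12 * (e * z) * (c / 2).
      by rewrite /z; field; lra.
    by rewrite ler_pM2l //; lra.
  lra.
Qed.

(** * Separation and slab bounds for a metric at unit scale *)

Section Estimates.
Context {R : realType} {n k : nat}.
Variables (d : 'I_n -> 'I_n -> R) (A C x : R).
Hypothesis md : is_metric d.
Hypothesis dA : forall i j, d i j <= A.
Hypothesis A0 : 0 < A.
Hypothesis C0 : 0 < C.
Hypothesis ball_ge : forall t i, 0 < t -> t <= A ->
  C^-1 * t `^ x * n%:R <= #|ball_set d t i|%:R.
Hypothesis ball_le : forall t i, 0 < t ->
  #|ball_set d t i|%:R <= Num.max (C * t `^ x * n%:R) 1.

(** The smallness of [rho] leaves at most [n / (2 * k)] points, or a single one, in each ball of
    radius [rho], so some point is far from all medoids and [medoids_separated] applies. *)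
Lemma medoids_distance_ge (m : {ffun 'I_k -> 'I_n}) (rho : R) g h :
  (k < n)%N -> local_optimum d m -> 0 < rho -> rho <= A ->
  2 * k%:R * C * rho `^ x <= 1 -> g != h ->
  C^-1 * (rho / 4) `^ x * rho ^+ 2 / (6 * A) <= d (m g) (m h).
Proof.
move=> kn opt rho0 rhoA small gh.
have n0 : 0 < n%:R :> R by rewrite ltr0n; exact: leq_ltn_trans kn.
have [j far] : exists j, forall l, rho < d (m l) j.
  apply: far_from_medoids md (fun i => ball_le rho i rho0) _.
  rewrite maxr_pMr // gt_max mulr1 ltr_nat kn andbT.
  have : 2 * k%:R * C * rho `^ x * n%:R <= 1 * n%:R by rewrite ler_pM2r.
  by rewrite mul1r !mulrA; lra.
have := medoids_separated d m A rho g h j md dA opt gh rho0 far.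
have rho4 : 0 < rho / 4 by lra.
have := ball_ge (rho / 4) j rho4 ltac:(lra).
set b := #|_|%:R; set v := _ `^ _; set e := d _ _ => bge sep.
have : C^-1 * v * n%:R * (rho ^+ 2 / 2) <= n%:R * (3 * A * e).
  by apply: le_trans sep; rewrite ler_pM2r // divr_gt0 ?exprn_gt0.
have -> : C^-1 * v * n%:R * (rho ^+ 2 / 2) = n%:R * (C^-1 * v * (rho ^+ 2 / 2)).
  by ring.
rewrite ler_pM2l // => le1.
rewrite ler_pdivrMr ?mulr_gt0 //; lra.
Qed.

Lemma slab_small nu (f : 'I_n -> 'rV[R]_nu) (K tau E : R) (M : nat) rho p q :
  coarse_isometry d K f ->
  (forall i j (a : R), 0 <= a <= 1 -> exists g,
    `|d i g - a * d i j| <= K /\ `|d g j - (1 - a) * d i j| <= K) ->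
  0 <= E -> 3 * K * (A + K) + 9 * K ^+ 2 <= E ^+ 2 ->
  let L := eucl_dist (f p) (f q) in
  (0 < M)%N -> (0 < n)%N -> 0 < L -> 0 < rho -> rho <= A ->
  1 <= C * rho `^ x * n%:R ->
  4 * (rho / 5) + 3 * K + 4 * E <= rho ->
  2 * (rho / 5) + K + 2 * E + 2 * (tau + 2 * K) * (A + K) / L
    < L / (4 * M%:R) ->
  #|[set i | `|d i p - d i q| <= tau]%SET|%:R <= C ^+ 2 * 5 `^ x / M%:R * n%:R.
Proof.
move=> iso itp E0 KE L M0 n0 L0 rho0 rhoA big rhoE LE.
have rho5 : 0 < rho / 5 by lra.
have := slab_card d f K A E md dA iso itp E0 KE M tau (rho / 5) rho _ _ p q
  M0 L0 rhoE LE (fun i => ball_ge _ i rho5 ltac:(lra))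
  (fun i => ball_le _ i rho0).
rewrite max_l //; set T := #|_|%:R.
have -> : rho `^ x = (rho / 5) `^ x * 5 `^ x.
  by rewrite -powRM ?divfK // ltW.
set v := _ `^ x; have v0 : 0 < v by exact: powR_gt0.
have n0' : 0 < n%:R :> R by rewrite ltr0n.
have M0' : 0 < M%:R :> R by rewrite ltr0n.
have -> : M%:R * T * (C^-1 * v * n%:R) = T * (C^-1 * M%:R * (v * n%:R)) by ring.
rewrite -ler_pdivlMr ?mulr_gt0 ?invr_gt0 // => /le_trans; apply.
rewrite le_eqVlt; apply/orP; left; apply/eqP; field.
by rewrite !gt_eqF.
Qed.

End Estimates.

Lemma limn_einf_gt0 {R : realType} (u : nat -> R) (c : R) : 0 < c ->
  (\forall n \near \oo, c <= u n) -> (0 < limn_einf (fun n => (u n)%:E))%E.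
Proof.
move=> c0 [N _ cu]; apply: (@lt_le_trans _ _ c%:E); first by rewrite lte_fin.
rewrite limn_einf_lim; apply: lime_ge; first exact: is_cvg_einfs.
exists N => // n /= Nn; apply: le_ereal_inf_tmp => _ [p /= np <-].
by rewrite lee_fin; apply: cu; exact: leq_trans np.
Qed.

(** * Constants uniform in [n], and the limits *)

Section Asymptotics.
Context {R : realType}.
Variables (X_d : forall n : nat, 'I_n -> 'I_n -> R) (C x K : R) (nu k : nat).
Variable cl : forall n : nat, 'I_n -> 'I_k.
Hypothesis md : forall n, is_metric (X_d n).
Hypotheses (C0 : 0 < C) (x1 : 1 <= x).
Hypothesis ahl : forall n, finite_ahlfors (X_d n) C x%:E.
Hypothesis k2 : (2 <= k)%N.
Hypothesis out : forall n, (k <= n)%N -> kmedoids_output (X_d n) (cl n).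

Let A : R := C `^ x^-1.
Let D n : R := n%:R `^ x^-1.
Let ds n i j : R := (D n)^-1 * X_d n i j.

Let A0 : 0 < A. Proof. exact: powR_gt0. Qed.
Let x0 : 0 < x. Proof. exact: lt_le_trans x1. Qed.
Let k0 : (0 < k)%N. Proof. exact: leq_trans k2. Qed.
Let D0 n : (0 < n)%N -> 0 < D n.
Proof. by move=> ?; rewrite powR_gt0 ?ltr0n. Qed.

Lemma separated_medoids : exists2 c, 0 < c & forall n, (k < n)%N ->
  exists2 m, nearest_assign (X_d n) m (cl n) &
    forall g h, g != h -> c <= ds n (m g) (m h).
Proof.
pose b := (2 * k%:R * C)^-1; have b0 : 0 < b.
  by rewrite invr_gt0 !mulr_gt0 // ltr0n.
pose rho := Num.min A (b `^ x^-1).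
have rho0 : 0 < rho by rewrite lt_min A0 powR_gt0.
exists (C^-1 * (rho / 4) `^ x * rho ^+ 2 / (6 * A)).
  by rewrite divr_gt0 ?mulr_gt0 ?exprn_gt0 ?powR_gt0 ?invr_gt0 ?divr_gt0.
move=> n kn; have n0 : (0 < n)%N by exact: leq_ltn_trans kn.
have [m0 [m [_ _ opt ma]]] := out n (ltnW kn); exists m => // g h gh.
have s0 : 0 < (D n)^-1 by rewrite invr_gt0 D0.
apply: (@medoids_distance_ge _ _ _ (ds n) A C x) gh => //.
- exact: is_metric_scale.
- exact: rescaled_diameter.
- by move=> *; exact: rescaled_ball_ge.
- by move=> *; exact: rescaled_ball_le.
- exact: local_optimum_scale.
- by rewrite ge_min lexx.
- rewrite -ler_pdivlMl ?mulr_gt0 ?ltr0n // mulr1 -/b.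
  apply: (@le_trans _ _ ((b `^ x^-1) `^ x)); last first.
    by rewrite -powRrM mulVf ?lt0r_neq0 // powRr1 // ltW.
  rewrite ge0_ler_powR ?nnegrE ?powR_ge0 ?(ltW x0) ?(ltW rho0) //.
  by rewrite ge_min lexx orbT.
Qed.

Section SeparatedMedoids.
Variables (c : R) (n : nat) (m : {ffun 'I_k -> 'I_n}).
Hypotheses (c0 : 0 < c) (n0 : (0 < n)%N).
Hypothesis ma : nearest_assign (X_d n) m (cl n).
Hypothesis sep : forall g h, g != h -> c <= ds n (m g) (m h).

Let s0 : 0 < (D n)^-1. Proof. by rewrite invr_gt0 D0. Qed.

Lemma separation_le : c <= A.
Proof.
have := sep (Ordinal k0) (Ordinal k2) isT => /le_trans; apply.
exact: rescaled_diameter.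
Qed.

Lemma cluster_size_ge g :
  C^-1 * (c / 3) `^ x * n%:R <= #|Defs.cluster (cl n) g|%:R.
Proof.
have c30 : 0 < c / 3 by rewrite divr_gt0.
have c3A : c / 3 <= A by have := separation_le; lra.
have := rescaled_ball_ge (X_d n) C C0 x x1 n0 (ahl n) (c / 3) (m g)
  c30 c3A.
move/le_trans; apply; rewrite ler_nat; apply: subset_leq_card.
apply: (@ball_sub_cluster _ _ _ (ds n) m) => //.
- exact: is_metric_scale.
- exact/nearest_assign_scale.
- by move=> h; apply: sep.
Qed.

Lemma min_cluster_size_linear :
  C^-1 * (c / 3) `^ x * n%:R <= (min_cluster_size (cl n))%:R.
Proof.
apply: min_cluster_size_ge cluster_size_ge.
apply: le_trans (cluster_size_ge (Ordinal k0)) _.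
by rewrite ler_nat -[leqRHS]card_ord max_card.
Qed.

Lemma cluster_size_ratio_ge : C^-1 * (c / 3) `^ x <=
  (min_cluster_size (cl n))%:R / (max_cluster_size (cl n))%:R.
Proof.
have c1 : 0 < C^-1 * (c / 3) `^ x.
  by rewrite mulr_gt0 ?invr_gt0 ?powR_gt0 ?divr_gt0.
rewrite ler_pdivlMr.
  apply: le_trans min_cluster_size_linear.
  by rewrite ler_pM2l // ler_nat max_cluster_size_le.
apply: (@lt_le_trans _ _ (C^-1 * (c / 3) `^ x * n%:R)).
  by rewrite mulr_gt0 // ltr0n.
apply: le_trans (cluster_size_ge (Ordinal k0)) _.
by rewrite ler_nat /max_cluster_size (bigD1 (Ordinal k0)) // leq_maxl.
Qed.

(** The long hypothesis is what [slab_parameters] provides; the bounds by [e ^+ 2 * D n] say that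
    the rescaled coarseness and slab thickness are at most [e ^+ 2]. *)
Lemma boundary_size_small (f : 'I_n -> 'rV[R]_nu) (r e : R) (M : nat) :
  coarse_isometry (X_d n) K f ->
  (forall (i j : 'I_n) (a : R), 0 <= a <= 1 ->
     exists g : 'I_n, `|X_d n i g - a * X_d n i j| <= K /\
                      `|X_d n g j - (1 - a) * X_d n i j| <= K) ->
  (0 < M)%N ->
  (forall K tau L, 0 <= K -> K <= e ^+ 2 -> tau <= e ^+ 2 ->
    c - K <= L -> exists E, [/\ 0 <= E, 0 < L,
      3 * K * (A + K) + 9 * K ^+ 2 <= E ^+ 2,
      4 * ((c / (16 * M%:R)) / 5) + 3 * K + 4 * E <= c / (16 * M%:R) &
      2 * ((c / (16 * M%:R)) / 5) + K + 2 * E + 2 * (tau + 2 * K) * (A + K) / L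
        < L / (4 * M%:R)]) ->
  K <= e ^+ 2 * D n -> 2 * r <= e ^+ 2 * D n ->
  1 <= C * (c / (16 * M%:R)) `^ x * n%:R ->
  (max_boundary_size (X_d n) (cl n) r)%:R <=
  k%:R * (C ^+ 2 * 5 `^ x / M%:R * n%:R).
Proof.
move=> iso itp M0 params KD rD big.
have M0' : 1 <= M%:R :> R by rewrite ler1n.
apply: (@max_boundary_size_le _ _ _ (X_d n) m) => //.
  by rewrite !mulr_ge0 ?invr_ge0 ?exprn_ge0 ?powR_ge0 // ltW.
move=> g h gh; pose K' := (D n)^-1 * K; pose tau := (D n)^-1 * (2 * r).
have iso' := coarse_isometry_scale _ _ s0 _ _ _ iso.
have mds := is_metric_scale _ _ s0 (md n).
have K'0 : 0 <= K' := coarse_constant_ge0 _ _ _ mds iso' (m g).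
have [||| E [E0 L0 KE rhoE LE]] := params K' tau
    (eucl_dist ((D n)^-1 *: f (m g)) ((D n)^-1 *: f (m h))) K'0.
- by rewrite ler_pdivrMl ?D0 // [leRHS]mulrC.
- by rewrite ler_pdivrMl ?D0 // [leRHS]mulrC.
- have [_] := iso' (m g) (m h); have := sep _ _ gh; rewrite /ds /K'; lra.
have := @slab_small R n (ds n) A C x mds _ C0 _ _ nu _ K' tau E M
  (c / (16 * M%:R)) (m g) (m h) iso' _ E0 KE M0 n0 L0 _ _ big rhoE LE.
have -> : [set i | `|ds n i (m g) - ds n i (m h)| <= tau]%SET =
  [set i | `|X_d n i (m g) - X_d n i (m h)| <= 2 * r]%SET.
  apply/setP => i; rewrite !inE /ds /tau -mulrBr normrM (gtr0_norm s0).
  by rewrite ler_pM2l.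
apply.
- exact: rescaled_diameter.
- by move=> *; exact: rescaled_ball_ge.
- by move=> *; exact: rescaled_ball_le.
- exact: interpolation_scale.
- by rewrite divr_gt0 ?mulr_gt0 //; lra.
- apply: le_trans separation_le; rewrite ler_pdivrMr; last lra.
  by rewrite -[leLHS]mulr1 ler_pM2l //; lra.
Qed.

End SeparatedMedoids.

Hypothesis iso :
  forall n, exists f : 'I_n -> 'rV[R]_nu, coarse_isometry (X_d n) K f.
Hypothesis itp : forall n (i j : 'I_n) (a : R), 0 <= a <= 1 ->
  exists g : 'I_n, `|X_d n i g - a * X_d n i j| <= K /\
                   `|X_d n g j - (1 - a) * X_d n i j| <= K.

(** The radius is the square root of [D n]: it is unbounded, yet negligible against the scale
    [D n]. *)
Lemma boundary_negligible :
  (fun n => (max_boundary_size (X_d n) (cl n) (n%:R `^ (2 * x)^-1))%:R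
            / (min_cluster_size (cl n))%:R : R) @ \oo --> 0.
Proof.
have [c c0 sepc] := separated_medoids.
pose c1 := C^-1 * (c / 3) `^ x.
have c10 : 0 < c1 by rewrite mulr_gt0 ?invr_gt0 ?powR_gt0 ?divr_gt0.
apply/cvgrPdist_le => eps eps0.
(* Choices are made in the order [eps], [M], [e], [n]. This [M] brings the boundary bound below
   [eps] times the least cluster size [c1 * n]. *)
pose M := (Num.truncn (k%:R * (C ^+ 2 * 5 `^ x) / (eps * c1))).+1.
have M0 : 0 < M%:R :> R by rewrite ltr0n.
have ltM : k%:R * (C ^+ 2 * 5 `^ x) / M%:R <= eps * c1.
  rewrite ler_pdivrMr // [leRHS]mulrC -ler_pdivrMr ?(mulr_gt0 eps0 c10) //.
  by rewrite ltW // truncnS_gt.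
have [e e0 params] := slab_parameters A c M%:R A0 c0 M0.
have rho0 : 0 < C * (c / (16 * M%:R)) `^ x.
  by rewrite mulr_gt0 ?powR_gt0 ?divr_gt0 ?mulr_gt0.
have e20 : 0 < e ^+ 2 by rewrite exprn_gt0.
have D_large : \forall n \near \oo, K / e ^+ 2 <= D n.
  by apply: (cvgryPge _).1; apply: cvg_natr_powR; rewrite invr_gt0.
have r_large : \forall n \near \oo, 2 / e ^+ 2 <= n%:R `^ (2 * x)^-1 :> R.
  by apply: (cvgryPge _).1; apply: cvg_natr_powR; rewrite invr_gt0 mulr_gt0.
have n_large := nbhs_infty_ger (1 / (C * (c / (16 * M%:R)) `^ x)).
have k_lt := nbhs_infty_gt k.
apply: (filterS _ (filterI k_lt (filterI D_large (filterI r_large n_large)))).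
move=> n [/= kn [nD [nr nn]]].
have n0 : (0 < n)%N by exact: leq_ltn_trans kn.
have [m ma sep] := sepc n kn; have [f isof] := iso n.
have r0 : 0 <= n%:R `^ (2 * x)^-1 :> R := powR_ge0 _ _.
have r2 : (n%:R `^ (2 * x)^-1) ^+ 2 = D n :> R.
  rewrite -powR_mulrn // -powRrM; congr (_ `^ _); field; exact: lt0r_neq0.
have min_ge := min_cluster_size_linear c n m c0 n0 ma sep.
have min0 : 0 < (min_cluster_size (cl n))%:R :> R.
  by apply: lt_le_trans min_ge; rewrite mulr_gt0 // ltr0n.
rewrite sub0r normrN ger0_norm ?divr_ge0 // ler_pdivrMr //.
apply: (@le_trans _ _ (eps * (c1 * n%:R))); last by rewrite ler_pM2l.
have := boundary_size_small c n m c0 n0 ma sep f (n%:R `^ (2 * x)^-1) e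
  M isof (itp n) isT params.
move=> bd; apply: le_trans (bd _ _ _) _.
- by rewrite [leRHS]mulrC -ler_pdivrMr.
- by rewrite -r2 expr2 mulrA ler_wpM2r // [leRHS]mulrC -ler_pdivrMr.
- by rewrite [leRHS]mulrC -ler_pdivrMr.
- by rewrite !mulrA ler_pM2r ?ltr0n //; rewrite !mulrA in ltM.
Qed.

End Asymptotics.

Theorem theorem3 (R : realType) (X_d : forall n : nat, 'I_n -> 'I_n -> R)
    (C : R) (delta : \bar R) (K : R) (nu k : nat)
    (cl : forall n : nat, 'I_n -> 'I_k) :
  (forall n, is_metric (X_d n)) ->
  0 < C -> (1%:E <= delta)%E ->
  (forall n, finite_ahlfors (X_d n) C delta) ->
  (forall n, exists f : 'I_n -> 'rV[R]_nu, coarse_isometry (X_d n) K f) ->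
  (forall n (i j : 'I_n) (a : R), 0 <= a <= 1 ->
     exists g : 'I_n, `|X_d n i g - a * X_d n i j| <= K /\
                      `|X_d n g j - (1 - a) * X_d n i j| <= K) ->
  (2 <= k)%N ->
  (forall n, (k <= n)%N -> kmedoids_output (X_d n) (cl n)) ->
  (0 < limn_einf (fun n => ((min_cluster_size (cl n))%:R
                            / (max_cluster_size (cl n))%:R : R)%:E))%E /\
  exists rbar : nat -> R,
    nondecreasing_seq rbar /\ rbar @ \oo --> +oo /\
    (fun n => (max_boundary_size (X_d n) (cl n) (rbar n))%:R
              / (min_cluster_size (cl n))%:R : R) @ \oo --> 0.
Proof.
move=> md C0 delta1 ahl iso itp k2 out.
case: delta delta1 ahl => [x|_ ahl|//]; last first.
  (* For [delta = +oo] a space with more than [Num.max C 1] points contradicts regularity. *)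
  have := finite_ahlfors_pinfty _ _ C0 (ahl (Num.truncn (Num.max C 1)).+1).
  by rewrite leNgt truncnS_gt.
rewrite lee_fin => x1 ahl.
have p0 : 0 < (2 * x)^-1 by rewrite invr_gt0 mulr_gt0 //; exact: lt_le_trans x1.
split.
  have [c c0 sepc] := separated_medoids X_d C x k cl md C0 x1 ahl k2 out.
  apply: (@limn_einf_gt0 _ _ (C^-1 * (c / 3) `^ x)).
    by rewrite mulr_gt0 ?invr_gt0 ?powR_gt0 ?divr_gt0.
  exists k.+1 => // n /= kn; have [m ma sep] := sepc n kn.
  apply: cluster_size_ratio_ge ma sep => //; exact: leq_ltn_trans kn.
exists (fun n => n%:R `^ (2 * x)^-1); split; [|split].
- move=> a b ab; rewrite ge0_ler_powR ?nnegrE ?ler_nat //; exact: ltW.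
- exact: cvg_natr_powR.
- exact: (boundary_negligible X_d C x K nu k cl).
Qed.
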